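(* Let $\{S_i\}_{i\in I}$ be an infinite iterated function system (IIFS) on $X\subset\mathbb{R}^d$ with limit set $F$ and let $h\in[0,\infty]$ be as defined in the context. For $n\in\mathbb{N}$ let $\mathcal{P}_n$ be the collection of sets $P\subseteq X$ such that $P\cap S_w(X)\neq\varnothing$ for all $w\in I^n$. Then: (1) $\dim_{\mathrm H}F\le h$; (2) $\overline{\dim}_{\mathrm B}F\le\max\{h,\ \lim_{n\to\infty}\inf\{\overline{\dim}_{\mathrm B}P:P\in\mathcal{P}_n\}\}$; (3) for all $\theta\in[0,1]$, $\overline{\dim}_{\theta}F\le\max\{h,\ \lim_{n\to\infty}\inf\{\overline{\dim}_{\theta}P:P\in\mathcal{P}_n\}\}$; (4) if $\Phi$ is monotonically admissible, then $\overline{\dim}^{\Phi}F\le\max\{h,\ \lim_{n\to\infty}\inf\{\overline{\dim}^{\Phi}P:P\in\mathcal{P}_n\}\}$.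
   Context: $|\cdot|$ denotes Euclidean diameter and $\|\cdot\|$ the Euclidean norm. IIFS. Let $d\in\mathbb{N}$ and let $X\subset\mathbb{R}^d$ be compact, connected, with more than one point. An infinite iterated function system (IIFS) on $X$ is a collection of maps $S_i\colon X\to X$, $i\in I$, with $I$ a countable index set, such that there is $\rho\in[0,1)$ with $\|S_i(x)-S_i(y)\|\le\rho\|x-y\|$ for all $x,y\in X$, $i\in I$. For $w=w_1\cdots w_n\in I^n$ let $S_w=S_{w_1}\circ\cdots\circ S_{w_n}$. For $w\in I^{\mathbb N}$, $w|_n$ denotes the word formed by its first $n$ letters. The limit set is $F=\bigcup_{w\in I^{\mathbb{N}}}\bigcap_{n=1}^\infty S_{w|_n}(X)$. Pressure and $h$. For a map $\sigma=S_w$ let $R_\sigma=\sup_{x,y\in X,x\ne y}\|\sigma(x)-\sigma(y)\|/\|x-y\|$. Let $M_n=\{S_w:w\in I^n\}$ (a set of maps, so coinciding maps are counted once), $\phi_n(t)=\sum_{\sigma\in M_n}R_\sigma^t\in[0,\infty]$, and $\overline{P}(t)=\lim_{n\to\infty}\frac1n\log\phi_n(t)=\inf_n\frac1n\log\phi_n(t)\in[-\infty,\infty]$ for $t\in(0,\infty)$ (with $\log\infty=\infty$, $\log 0=-\infty$). Put $h=\inf\{t>0:\overline{P}(t)<0\}$ ($\inf\varnothing=\infty$). Dimensions. $\dim_{\mathrm H},\overline{\dim}_{\mathrm B}$ are the Hausdorff and upper box dimensions. For $\theta\in(0,1]$ and non-empty bounded $E\subset\mathbb{R}^d$, $\overline{\dim}_{\theta}E$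 is the infimum of $s\ge0$ such that for all $\epsilon>0$ there is $\delta_0\in(0,1]$ such that for all $\delta\in(0,\delta_0)$ there is a cover $\{U_1,U_2,\ldots\}$ of $E$ with $\delta^{1/\theta}\le|U_i|\le\delta$ for all $i$ and $\sum_i|U_i|^s\le\epsilon$; so $\overline{\dim}_1=\overline{\dim}_{\mathrm B}$. Set $\overline{\dim}_0=\dim_{\mathrm H}$. A function $\Phi\colon(0,\Delta)\to\mathbb{R}$ is monotonically admissible if it is monotonic, $0<\Phi(\delta)\le\delta$ for all $\delta\in(0,\Delta)$, and $\Phi(\delta)/\delta\to0$ monotonically as $\delta\to0^+$. $\overline{\dim}^{\Phi}E$ is defined like $\overline{\dim}_\theta E$ with $\delta^{1/\theta}$ replaced by $\Phi(\delta)$ (for $\delta<\Delta$). *)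

(* Defs.v *)
From HB Require Import structures.
From mathcomp Require Import all_boot all_order all_algebra.
From mathcomp Require Import all_classical all_reals all_analysis.
Import Order.TTheory GRing.Theory Num.Theory.
Import numFieldNormedType.Exports.

Set Implicit Arguments.
Unset Strict Implicit.
Unset Printing Implicit Defensive.

Local Open Scope classical_set_scope.
Local Open Scope ring_scope.

Section Dimensions.
Context {R : realType} {d : nat}.
Implicit Types (x y : 'rV[R]_d) (E U : set 'rV[R]_d) (C : set (set 'rV[R]_d)).

(* The library norm on ['rV[R]_d] is the sup norm, which induces the same
   topology, but diameters and Lipschitz constants depend on the norm. *)
Definition enorm x : R := Num.sqrt (\sum_(i < d) x ord0 i ^+ 2).

(* The value 0 is joined to the set of distances so that the empty set has
   diameter 0. *)
Definition diam U : \bar R :=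
  ereal_sup (0%E |` [set r | exists x y,
    [/\ U x, U y & r = (enorm (x - y))%:E]]).

(* Covers by finitely or countably many sets are countable sets of sets. *)
Definition countable_cover E C : Prop :=
  countable C /\ E `<=` \bigcup_(U in C) U.

Definition diam_sum (s : R) C : \bar R := \esum_(U in C) (diam U `^ s)%E.

Definition hausdorff_premeasure (s delta : R) E : \bar R :=
  ereal_inf [set diam_sum s C | C in [set C | countable_cover E C /\
    forall U, C U -> (diam U <= delta%:E)%E]].

Definition hausdorff_measure (s : R) E : \bar R :=
  ereal_sup [set hausdorff_premeasure s delta E
            | delta in [set delta | 0 < delta]].

Definition hausdorff_dim E : \bar R :=
  ereal_inf [set s%:E | s in [set s | 0 <= s /\ hausdorff_measure s E = 0%E]].

(* Least number of sets of diameter at most [delta] that cover [E]. *)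
Definition covering_number (delta : R) E : \bar R :=
  ereal_inf [set n%:R%:E | n in [set n : nat |
    exists U : 'I_n -> set 'rV[R]_d,
      E `<=` \bigcup_(i in [set: 'I_n]) U i /\
      forall i, (diam (U i) <= delta%:E)%E]].

Definition upper_box_dim E : \bar R :=
  limf_esup
    (fun delta : R => (lne (covering_number delta E) * ((- ln delta)^-1)%:E)%E)
    (0^'+).

(* [Phi] is only evaluated on ]0, Delta[. *)
Definition upper_Phi_dim (Delta : R) (Phi : R -> R) E : \bar R :=
  ereal_inf [set s%:E | s in [set s | 0 <= s /\
    forall eps : R, 0 < eps ->
    exists delta0 : R, [/\ 0 < delta0, delta0 <= 1 &
      forall delta : R, 0 < delta -> delta < delta0 -> delta < Delta ->
      exists C, [/\ countable_cover E C,
        forall U, C U -> ((Phi delta)%:E <= diam U)%E /\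
                         (diam U <= delta%:E)%E
        & (diam_sum s C <= eps%:E)%E]]]].

Definition upper_theta_dim (theta : R) E : \bar R :=
  if theta == 0 then hausdorff_dim E
  else upper_Phi_dim 1 (fun delta => delta `^ theta^-1) E.

End Dimensions.

Definition monotonically_admissible {R : realType} (Delta : R) (Phi : R -> R) :
    Prop :=
  [/\ 0 < Delta,
      {in `]0, Delta[ &, {homo Phi : x y / x <= y}} \/
      {in `]0, Delta[ &, {homo Phi : x y / x <= y >-> y <= x}},
      forall delta, 0 < delta < Delta -> 0 < Phi delta <= delta,
      (fun delta => Phi delta / delta) @ 0^'+ --> (0 : R)
    & {in `]0, Delta[ &, {homo (fun delta => Phi delta / delta) :
        x y / x <= y}}].

Section IIFS.
Context {R : realType} {d : nat} {X : set 'rV[R]_d} {I : Type}.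

(* [X -> X] is the type of maps between subtypes, so two compositions are the
   same map exactly when they coincide on [X]. *)
Definition is_IIFS (S : I -> X -> X) : Prop :=
  [/\ compact X, connected X,
      exists x y, [/\ X x, X y & x <> y],
      countable [set: I]
    & exists rho : R, 0 <= rho < 1 /\
        forall i (x y : X),
          enorm (val (S i x) - val (S i y)) <= rho * enorm (val x - val y)].

Variable S : I -> X -> X.

(* Composition is left to right: [comp_word [:: i; j] x = S i (S j x)]. *)
Definition comp_word (w : seq I) : X -> X :=
  foldr (fun i f => S i \o f) id w.

Definition cylinder (w : seq I) : set 'rV[R]_d :=
  range (fun x : X => val (comp_word w x)).

Definition limit_set : set 'rV[R]_d :=
  \bigcup_(w in [set: nat -> I])
    \bigcap_(n in [set n : nat | (0 < n)%N]) cylinder (mkseq w n).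

Definition word_maps (n : nat) : set (X -> X) :=
  [set comp_word w | w in [set w : seq I | size w = n]].

(* A supremum in [R]: under [is_IIFS] the ratios form a nonempty set bounded
   by 1. *)
Definition lip (sigma : X -> X) : R :=
  sup [set r | exists x y : X, x <> y /\
    r = enorm (val (sigma x) - val (sigma y)) / enorm (val x - val y)].

Definition phi (n : nat) (t : R) : \bar R :=
  \esum_(sigma in word_maps n) (lip sigma `^ t)%:E.

(* By submultiplicativity of [phi ^~ t] this infimum is the limit of the same
   sequence whenever that limit exists. It may fail to exist when [phi n t] is
   infinite for some but not all [n], so the infimum is used. *)
Definition pressure (t : R) : \bar R :=
  ereal_inf [set ((n%:R^-1)%:E * lne (phi n t))%E
            | n in [set n : nat | (0 < n)%N]].

Definition h_exponent : \bar R :=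
  ereal_inf [set t%:E | t in [set t | 0 < t /\ (pressure t < 0)%E]].

Definition hitting_sets (n : nat) : set (set 'rV[R]_d) :=
  [set P | P `<=` X /\
    forall w : seq I, size w = n -> P `&` cylinder w !=set0].

Definition lim_hitting_dim (dim : set 'rV[R]_d -> \bar R) : \bar R :=
  limn (fun n => ereal_inf [set dim P | P in hitting_sets n]).

End IIFS.

(* Main.v *)
Require Import Defs.
From mathcomp Require Import all_boot all_order all_algebra.
From mathcomp Require Import all_classical all_reals all_analysis.
From mathcomp Require Import finmap ring lra.
Import Order.TTheory GRing.Theory Num.Theory.
Import numFieldNormedType.Exports.
(** Let [s] exceed the right-hand side. As [h_exponent S < s], some [n] has
    [phi S n s < 1]: the maps [sigma] in [word_maps S n] contract sums of [s]-th
    powers of diameters. For every [k], the limit set lies in the union of the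
    cylinders of length [n * k], and the union for [k.+1] is covered by the
    images under these maps of the union for [k].

    For the Hausdorff dimension, a single set covering [X] is transported
    through [k] levels ([has_cover_level_small]); the sums decay like the [k]-th
    power of [phi S n s], and the diameters tend to 0.

    For the other dimensions the diameters must stay above [Phi delta], and small
    cylinders cannot be used individually. They all meet a set [P] of dimension
    less than [s], so they are near [P] and a thickened cover of [P] takes care
    of them. For a large cylinder, a cover at a larger scale is transported from
    the previous level. The resulting recursive inequality for the sums has
    contraction factor [phi S n s], so they are bounded uniformly in [delta]
    ([has_cover_limit_set]); at exponents above [s] they tend to 0. The box
    dimension is the case in which all diameters equal [delta].

    Three facts about Euclidean space enter. A set can be enlarged to have any
    prescribed larger diameter ([diam_enlarge]), so transported and thickened
    covers only need upper bounds on the diameters. A ball is covered by boundedly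
    many sets of a fixed fraction of its radius, so thickening costs a constant
    factor ([has_cover_fatten]). And [X], being compact, has finite covers by
    small sets, which handles cylinders of intermediate size
    ([has_cover_cylinder]). *)

Set Implicit Arguments.
Unset Strict Implicit.
Local Open Scope classical_set_scope.
Local Open Scope ring_scope.

(** * Euclidean norm and diameter *)

Section EuclideanDiameter.
Context {R : realType} {d : nat}.
Implicit Types (x y z u : 'rV[R]_d) (U V W : set 'rV[R]_d) (r a : R).

Lemma enorm_ge0 x : 0 <= enorm x.
Proof. exact: sqrtr_ge0. Qed.

Lemma sqr_enorm x : enorm x ^+ 2 = \sum_(i < d) x ord0 i ^+ 2.
Proof. by rewrite sqr_sqrtr// sumr_ge0// => i _; rewrite sqr_ge0. Qed.

Lemma enormN x : enorm (- x) = enorm x.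
Proof. by rewrite /enorm; under eq_bigr do rewrite mxE sqrrN. Qed.

Lemma enorm_subC x y : enorm (x - y) = enorm (y - x).
Proof. by rewrite -enormN opprB. Qed.

Lemma enormZ a x : enorm (a *: x) = `|a| * enorm x.
Proof.
rewrite /enorm; under eq_bigr do rewrite mxE exprMn.
by rewrite -mulr_sumr sqrtrM ?sqr_ge0// sqrtr_sqr.
Qed.

Lemma enorm0 : enorm (0 : 'rV[R]_d) = 0.
Proof. by rewrite -(scale0r 0) enormZ normr0 mul0r. Qed.

Lemma enorm_eq0 x : enorm x = 0 -> x = 0.
Proof.
move=> x0; apply/rowP => i; rewrite mxE; apply/eqP; rewrite -sqrf_eq0.
have /eqP := sqr_enorm x; rewrite x0 expr0n/= eq_sym.
rewrite psumr_eq0 => [/allP/(_ i)|j _]; last by rewrite sqr_ge0.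
by rewrite mem_index_enum => /(_ isT).
Qed.

Lemma enorm_gt0 x : x != 0 -> 0 < enorm x.
Proof.
by move=> x0; rewrite lt0r enorm_ge0 andbT; apply: contra_neq x0 => /enorm_eq0.
Qed.

Lemma cauchy_schwarz x y :
  \sum_(i < d) x ord0 i * y ord0 i <= enorm x * enorm y.
Proof.
have [->|x0] := eqVneq x 0.
  by rewrite enorm0 mul0r big1// => i _; rewrite mxE mul0r.
have [->|y0] := eqVneq y 0.
  by rewrite enorm0 mulr0 big1// => i _; rewrite mxE mulr0.
have a0 := enorm_gt0 x0; have b0 := enorm_gt0 y0.
set a := enorm x; set b := enorm y; set p := \sum_(i < d) _.
(* AM-GM applied coordinatewise to [b *: x] and [a *: y]. *)
have : 2 * (a * b) * p <= b ^+ 2 * a ^+ 2 + a ^+ 2 * b ^+ 2.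
  have -> : b ^+ 2 * a ^+ 2 + a ^+ 2 * b ^+ 2 =
      b ^+ 2 * (\sum_(i < d) x ord0 i ^+ 2) + a ^+ 2 * (\sum_(i < d) y ord0 i ^+ 2).
    by rewrite -!sqr_enorm.
  rewrite !mulr_sumr -big_split/= ler_sum// => i _.
  have := sqr_ge0 (b * x ord0 i - a * y ord0 i); lra.
have ab0 : 0 < a * b by rewrite mulr_gt0.
move=> H; rewrite -(@ler_pM2l _ (2 * (a * b))) ?mulr_gt0//.
by apply: le_trans H _; rewrite le_eqVlt; apply/orP; left; apply/eqP; ring.
Qed.

Lemma enormD x y : enorm (x + y) <= enorm x + enorm y.
Proof.
rewrite -(@ler_pXn2r _ 2) ?nnegrE ?addr_ge0 ?enorm_ge0//.
rewrite sqrrD !sqr_enorm.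
under eq_bigr do rewrite mxE sqrrD.
rewrite !big_split/= lerD2r lerD2l.
by rewrite mulr2n lerD ?cauchy_schwarz.
Qed.

Lemma enorm_triangle y x z : enorm (x - z) <= enorm (x - y) + enorm (y - z).
Proof. by rewrite -(subrKA y x (- z)) enormD. Qed.

Lemma diam_leP U r :
  (diam U <= r%:E)%E <->
  0 <= r /\ forall x y, U x -> U y -> enorm (x - y) <= r.
Proof.
split=> [Ur|[r0 Ur]].
  split; first by rewrite -lee_fin (le_trans _ Ur)//; apply: ereal_sup_ubound; left.
  move=> x y Ux Uy; rewrite -lee_fin (le_trans _ Ur)//.
  by apply: ereal_sup_ubound; right; exists x, y.
by apply: ge_ereal_sup => _ [->|[x [y [Ux Uy ->]]]]; rewrite lee_fin//; exact: Ur.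
Qed.

Lemma diam_ge0 U : (0 <= diam U)%E.
Proof. by apply: ereal_sup_ubound; left. Qed.

Lemma diam_fin U r : (diam U <= r%:E)%E -> diam U = (fine (diam U))%:E.
Proof.
move=> Ur; rewrite fineK// ge0_fin_numE ?diam_ge0//.
by rewrite (le_lt_trans Ur)// ltry.
Qed.

Lemma enorm_le_diam U x y : (diam U < +oo)%E -> U x -> U y ->
  enorm (x - y) <= fine (diam U).
Proof.
move=> Uoo; have Ufin : diam U \is a fin_num by rewrite ge0_fin_numE ?diam_ge0.
have /diam_leP[_] : (diam U <= (fine (diam U))%:E)%E by rewrite fineK.
exact.
Qed.

(** Adding to [V] one point [v + l e], with [v] in [V] and [e] a unit vector,
    changes the diameter continuously in [l]; the largest [l <= r] for which the
    diameter does not exceed [r] makes it equal to [r]. *)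
Lemma diam_enlarge V r : (0 < d)%N -> (diam V <= r%:E)%E ->
  exists2 W, V `<=` W & diam W = r%:E.
Proof.
move=> d0 Vr.
wlog [v Vv] : V Vr / V !=set0.
  move=> H; have [V0|/nonemptyPn ->] := pselect (V !=set0); first exact: H.
  have [|W _ Wr] := H [set 0] _ (ex_intro _ 0 erefl); last by exists W.
  have [r0 _] := (diam_leP V r).1 Vr.
  by apply/diam_leP; split => // x y -> ->; rewrite subrr enorm0.
have [r0 VV] := (diam_leP V r).1 Vr.
pose i0 := Ordinal d0; pose e : 'rV[R]_d := delta_mx ord0 i0.
have e1 : enorm e = 1.
  rewrite /enorm (bigD1 i0)//= big1 ?addr0 ?mxE ?eqxx ?expr1n ?sqrtr1//.
  by move=> i /negbTE ii0; rewrite mxE ii0 andbF expr0n.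
pose L := [set l : R | 0 <= l <= r /\
             forall y, V y -> enorm (y - (v + l *: e)) <= r].
have Lsup : has_sup L.
  split; last by exists r => l [/andP[]].
  by exists 0; split; rewrite ?lexx// => y Vy; rewrite scale0r addr0; exact: VV.
have L0 : L 0.
  by split; rewrite ?lexx// => y Vy; rewrite scale0r addr0; exact: VV.
pose m := sup L.
have m0 : 0 <= m by apply: sup_upper_bound.
have mr : m <= r by apply: ge_sup; [by exists 0|move=> l [/andP[]]].
have step l k y : enorm (y - (v + l *: e)) <= enorm (y - (v + k *: e)) + `|k - l|.
  apply: le_trans (enorm_triangle (v + k *: e) _ _) _.
  by rewrite lerD2l opprD addrACA subrr add0r -scalerBl enormZ e1 mulr1.
have yr y : V y -> enorm (y - (v + m *: e)) <= r.
  move=> Vy; apply/ler_addgt0Pr => eps eps0.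
  have [l Ll ml] := sup_adherent eps0 Lsup.
  apply: le_trans (step _ l _) _; apply: lerD; first by case: Ll => _; exact.
  have lm : l <= m by exact: sup_upper_bound.
  rewrite distrC ger0_norm ?subr_ge0//; move: ml; rewrite -/m; lra.
exists (V `|` [set v + m *: e]); first by move=> y; left.
apply/eqP; rewrite eq_le; apply/andP; split.
  apply/diam_leP; split => // x y [Vx|->] [Vy|->].
  - exact: VV.
  - exact: yr.
  - by rewrite enorm_subC; exact: yr.
  - by rewrite subrr enorm0.
have [->|mnr] := eqVneq m r.
  apply: ereal_sup_ubound; right; exists (v + r *: e), v; split; [by right|by left|].
  by rewrite addrC addKr enormZ e1 mulr1 ger0_norm.
have ltmr : m < r by rewrite lt_neqAle mnr.
apply/lee_addgt0Pr => eps eps0.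
pose k := Num.min r (m + eps).
have mk : m < k by rewrite lt_min ltmr ltrDl.
have : ~ L k.
  by move=> /(sup_upper_bound Lsup); rewrite -/m leNgt mk.
move=> nLk.
have [y Vy ry] : exists2 y, V y & r < enorm (y - (v + k *: e)).
  apply: contrapT => H; apply: nLk; split.
    by rewrite (le_trans m0 (ltW mk)) /k ge_min lexx.
  by move=> y Vy; rewrite leNgt; apply/negP => ?; apply: H; exists y.
apply: (@le_trans _ _ (enorm (y - (v + m *: e)) + eps)%:E).
  rewrite lee_fin; apply/ltW/(lt_le_trans ry)/(le_trans (step _ m _)).
  rewrite lerD2l distrC ger0_norm ?subr_ge0 ?(ltW mk)// lerBlDl.
  by rewrite /k ge_min lexx orbT.
rewrite EFinD leeD2r//; apply: ereal_sup_ubound; right.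
by exists y, (v + m *: e); split; [left|right|].
Qed.

End EuclideanDiameter.

(** * Compact sets in the Euclidean norm *)

Section Geometry.
Context {R : realType} {d : nat}.
Implicit Types (X : set 'rV[R]_d).

Lemma exprn_small (rho eps : R) : 0 <= rho < 1 -> 0 < eps ->
  \forall k \near \oo, rho ^+ k < eps.
Proof.
move=> /andP[rho0 rho1] eps0.
have rn : `|rho| < 1 by rewrite ger0_norm.
have /cvgrPdist_lt/(_ _ eps0) := cvg_expr rn; apply: filterS => k; rewrite sub0r normrN.
by rewrite ger0_norm// exprn_ge0.
Qed.

(** The balls of the topology on row vectors are cubes. *)
Lemma enorm_le_ball (x y : 'rV[R]_d) (e : R) : ball x e y ->
  enorm (x - y) <= d%:R * e.
Proof.
move=> [e0 xye]; rewrite -(@ler_pXn2r _ 2) ?nnegrE ?mulr_ge0 ?enorm_ge0 ?(ltW e0)//.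
rewrite sqr_enorm; apply: (@le_trans _ _ (\sum_(i < d) e ^+ 2)).
  apply: ler_sum => i _; rewrite !mxE -real_normK ?num_real//.
  rewrite ler_pXn2r ?nnegrE ?(ltW e0)//.
  by have := xye ord0 i; rewrite -ball_normE/= => /ltW.
rewrite sumr_const card_ord -[leLHS]mulr_natl exprMn; apply: ler_wpM2r.
  exact: sqr_ge0.
by rewrite -natrX ler_nat -mulnn; case: (d) => // n; rewrite leq_pmulr.
Qed.

Lemma compact_finite_cover X (eta : R) : 0 < eta -> compact X ->
  exists (J : set 'rV[R]_d) (W : 'rV[R]_d -> set 'rV[R]_d),
  [/\ finite_set J, X `<=` \bigcup_(i in J) W i &
      forall i, (diam (W i) <= eta%:E)%E].
Proof.
move=> eta0; rewrite compact_cover => cX.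
pose r := eta / (d%:R + d%:R + 1).
have n0 : 0 < d%:R + d%:R + 1 :> R by rewrite ltr_wpDl// addr_ge0.
have r0 : 0 < r by rewrite divr_gt0.
have [||J _ XJ] := cX _ X (fun x => ball x r).
- by move=> x _; exact: ball_open.
- by move=> x Xx; exists x => //; exact: ballxx.
exists [set` J], (fun x => ball x r); split => // x.
apply/diam_leP; split; first exact: ltW.
move=> y z /enorm_le_ball xy /enorm_le_ball xz.
apply: le_trans (enorm_triangle x _ _) _; rewrite enorm_subC.
apply: le_trans (lerD xy xz) _; rewrite -mulrDl /r mulrA.
rewrite ler_pdivrMr// mulrC ler_pM2l//; lra.
Qed.

Lemma compact_enorm_bounded X : compact X ->
  exists2 D : R, 0 < D & forall x y, X x -> X y -> enorm (x - y) <= D.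
Proof.
move=> /compact_bounded[M [_ /(_ (`|M| + 1)) XM]].
have M1 : M < `|M| + 1 by rewrite ltr_pwDr// ler_norm.
have {}XM x : X x -> `|x| <= `|M| + 1 by exact: XM.
have X0 x : X x -> enorm (0 - x) <= d%:R * (`|M| + 2).
  move=> /XM xM; apply: enorm_le_ball; rewrite -ball_normE/= sub0r normrN.
  by apply: le_lt_trans xM _; rewrite ltrD2l ltr1n.
exists (d%:R * (`|M| + 2) + d%:R * (`|M| + 2) + 1).
  by rewrite ltr_wpDl// addr_ge0// mulr_ge0// addr_ge0.
move=> x y /X0 x0 /X0 y0; apply: le_trans (enorm_triangle 0 _ _) _.
rewrite enorm_subC; lra.
Qed.

Lemma cube_compact (c : R) : compact [set v : 'rV[R]_d | forall i, - c <= v ord0 i <= c].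
Proof.
have := @rV_compact R d (fun=> `[- c, c]%classic) (fun=> @segment_compact R (- c) c).
by congr compact; apply/seteqP; split=> v /= vc i; have := vc i; rewrite in_itv.
Qed.

Lemma enorm_le_cube (c : R) (x : 'rV[R]_d) : enorm x <= c ->
  forall i, - c <= x ord0 i <= c.
Proof.
move=> xc i; rewrite -ler_norml; apply: le_trans xc.
rewrite -[leLHS]sqrtr_sqr ler_sqrt; last by rewrite sumr_ge0// => j _; exact: sqr_ge0.
by rewrite (bigD1 i)//= lerDl sumr_ge0// => j _; exact: sqr_ge0.
Qed.

End Geometry.

(** * Sums and covers with constrained diameters *)

Section ExtendedSums.
Context {R : realType}.
Local Open Scope ereal_scope.

Lemma subset_esum (T : choiceType) (A B : set T) (f : T -> \bar R) :
  A `<=` B -> \esum_(i in A) f i <= \esum_(i in B) f i.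
Proof.
move=> AB; apply: ge_ereal_sup => _ [F [finF FA] <-].
by apply: esum_ge; exists F => //; split => // x /FA /AB.
Qed.

(** Coinciding images are counted once on the left. *)
Lemma esum_image_le (T U : choiceType) (A : set T) (f : T -> U)
    (g : U -> \bar R) :
  \esum_(y in f @` A) g y <= \esum_(x in A) g (f x).
Proof.
have [->|/set0P[a Aa]] := eqVneq A set0.
  by rewrite image_set0 !esum_set0.
have /choice[k kP] : forall y, exists x, A x /\ ((f @` A) y -> f x = y).
  move=> y; have [[x Ax fxy]|?] := pselect ((f @` A) y); first by exists x.
  by exists a.
rewrite (_ : \esum_(y in _) _ = \esum_(y in f @` A) g (f (k y))); last first.
  by apply: eq_esum => y /(kP y).2 ->.
rewrite -(esum_image (f @` A) k (g \o f)); last first.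
  by move=> x y /set_mem /(kP x).2 + /set_mem /(kP y).2 => {2}<- {2}<- ->.
by apply: subset_esum => _ [y _ <-]; exact: (kP y).1.
Qed.

Lemma esumZl_le (T : choiceType) (A : set T) (f : T -> \bar R) (c : R) :
  (0 <= c)%R -> (forall i, 0 <= f i) ->
  \esum_(i in A) (c%:E * f i) <= c%:E * \esum_(i in A) f i.
Proof.
move=> c0 f0; apply: ge_ereal_sup => _ [F [finF FA] <-].
rewrite -ge0_mule_fsumr// lee_wpmul2l ?lee_fin//.
by apply: esum_ge; exists F.
Qed.

Lemma esum1_fin_num (T : choiceType) (A : set T) : finite_set A ->
  (\esum_(i in A) 1%:E : \bar R) \is a fin_num.
Proof.
move=> finA; rewrite -[A]set_mem_set esum_fset//; last by rewrite set_mem_set.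
by rewrite fsbig_finite ?set_mem_set//= sumEFin.
Qed.

End ExtendedSums.

Section Covers.
Context {R : realType} {d : nat}.
Hypothesis d_gt0 : (0 < d)%N.
Implicit Types (E P U V : set 'rV[R]_d) (C : set (set 'rV[R]_d)).
Implicit Types (a b s c : R) (A B : \bar R).

(** The dimensions differ only in the window allowed for the diameters: [a = 0]
    for the Hausdorff dimension, [a = Phi b] for [upper_Phi_dim], and [a = b] for
    the box dimension, where the sum of [s]-th powers counts the sets. *)
Definition has_cover a b s A E : Prop :=
  exists C, [/\ countable_cover E C,
    forall U, C U -> (a%:E <= diam U)%E /\ (diam U <= b%:E)%E
    & (diam_sum s C <= A)%E].

Lemma has_cover_widen a b s A E a' b' A' E' :
  a' <= a -> b <= b' -> (A <= A')%E -> E' `<=` E ->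
  has_cover a b s A E -> has_cover a' b' s A' E'.
Proof.
move=> aa bb AA EE [C [[cC EC] Cab CA]]; exists C; split.
- by split => // x /EE /EC.
- move=> U /Cab[aU Ub]; split; first by rewrite (le_trans _ aU)// lee_fin.
  by rewrite (le_trans Ub)// lee_fin.
- exact: le_trans AA.
Qed.

(** Upper bounds [r i] on the diameters suffice to produce a cover: each set can
    be enlarged to have diameter exactly [r i], so the lower bound [a] is free. *)
Lemma has_cover_family (T : choiceType) (D : set T) (V : T -> set 'rV[R]_d)
    (r : T -> R) a b s E :
  countable D -> E `<=` \bigcup_(i in D) V i ->
  (forall i, D i -> (diam (V i) <= (r i)%:E)%E) ->
  (forall i, D i -> a <= r i <= b) ->
  has_cover a b s (\esum_(i in D) (r i `^ s)%:E) E.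
Proof.
move=> cD EV Vr rab.
have /choice[W WP] : forall i, exists W, D i -> V i `<=` W /\ diam W = (r i)%:E.
  move=> i; have [Di|?] := pselect (D i); last by exists set0.
  by have [W VW Wr] := diam_enlarge d_gt0 (Vr i Di); exists W.
exists (W @` D); split.
- split; first by apply: sub_countable cD; exact: card_image_le.
  move=> x /EV[i Di Vx]; exists (W i); first by exists i.
  exact: (WP i Di).1.
- by move=> _ [i Di <-]; rewrite (WP i Di).2 !lee_fin; exact/andP/rab.
- apply: le_trans (esum_image_le _ _ _) _.
  by apply: le_esum => i Di; rewrite (WP i Di).2 poweR_EFin.
Qed.

Lemma has_cover_set0 a b s A : (0 <= A)%E -> has_cover a b s A set0.
Proof.
by move=> A0; exists set0; split => //; [split|rewrite /diam_sum esum_set0].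
Qed.

Lemma has_cover_bigcup (J : choiceType) (D : set J) (E : J -> set 'rV[R]_d)
    (A : J -> \bar R) a b s :
  countable D -> (forall j, D j -> has_cover a b s (A j) (E j)) ->
  has_cover a b s (\esum_(j in D) A j) (\bigcup_(j in D) E j).
Proof.
move=> cD EA.
have /choice[C CP] : forall j, exists C, D j -> [/\ countable_cover (E j) C,
    forall U, C U -> (a%:E <= diam U)%E /\ (diam U <= b%:E)%E
    & (diam_sum s C <= A j)%E].
  move=> j; have [Dj|?] := pselect (D j); last by exists set0.
  by have [C ?] := EA j Dj; exists C.
exists (snd @` (D `*`` C)); split.
- split.
    apply: (@sub_countable _ _ _ (D `*`` C)); first exact: card_image_le.
    by apply: countableXR => // j /CP[[]].
  move=> x [j Dj]; have [[_ EC] _ _] := CP j Dj => /EC[U CU Ux].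
  by exists U => //; exists (j, U).
- by move=> _ [[j U] [/= Dj CU] <-]; have [_ + _] := CP j Dj; exact.
- apply: le_trans (esum_image_le _ _ _) _.
  rewrite -(@esum_esum _ _ _ D C (fun _ U => (diam U `^ s)%E)); last first.
    by move=> *; exact: poweR_ge0.
  by apply: le_esum => j /CP[].
Qed.

Lemma has_coverU a b s A B E P : (0 <= A)%E -> (0 <= B)%E ->
  has_cover a b s A E -> has_cover a b s B P ->
  has_cover a b s (A + B) (E `|` P).
Proof.
move=> A0 B0 EA PB.
have := @has_cover_bigcup _ [set: bool] (fun i => if i then E else P)
  (fun i => if i then A else B) a b s (countableP _).
rewrite (_ : [set: bool] = [set` [:: true; false]]); last first.
  by apply/seteqP; split => -[].
rewrite esum_fset//; last by case.
rewrite -fsbig_seq//= !big_cons big_nil adde0 => H.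
apply: has_cover_widen (H _) => //; last by case.
by move=> x [?|?]; [exists true|exists false].
Qed.

(** The image under [f] of a member of a cover has diameter at most [c] times
    the original one; enlarging the image to exactly that diameter transports
    the lower bound on diameters as well. *)
Lemma has_cover_image (X : set 'rV[R]_d) (f : X -> 'rV[R]_d) c a b s A E :
  0 <= c ->
  (forall x y : X, enorm (f x - f y) <= c * enorm (val x - val y)) ->
  has_cover a b s A E ->
  has_cover (c * a) (c * b) s ((c `^ s)%:E * A) (f @` [set x | E (val x)]).
Proof.
move=> c0 fc [C [[cC EC] Cab CA]].
pose r U := c * fine (diam U).
have fin U : C U -> diam U = (fine (diam U))%:E by move=> /Cab[_ /diam_fin].
apply: (@has_cover_widen (c * a) (c * b) s (\esum_(U in C) (r U `^ s)%:E)
  (f @` [set x | E (val x)])) => //.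
  apply: (@le_trans _ _ ((c `^ s)%:E * diam_sum s C)%E); last first.
    by rewrite lee_wpmul2l// lee_fin powR_ge0.
  apply: le_trans (esumZl_le _ _ _); last 2 first.
  - exact: powR_ge0.
  - by move=> U; exact: poweR_ge0.
  apply: le_esum => U CU; rewrite [in leRHS]fin//.
  by rewrite poweR_EFin -EFinM lee_fin powRM// fine_ge0// diam_ge0.
apply: (@has_cover_family _ C (fun U => f @` [set x | U (val x)])) => //.
- by move=> _ [x Ex <-]; have [U CU Ux] := EC _ Ex; exists U => //; exists x.
- move=> U CU; apply/diam_leP; split.
    by rewrite mulr_ge0// fine_ge0// diam_ge0.
  move=> _ _ [x Ux <-] [y Uy <-]; apply: le_trans (fc x y) _.
  rewrite ler_wpM2l//; apply: enorm_le_diam => //.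
  by have [_ Ub] := Cab U CU; rewrite (le_lt_trans Ub)// ltry.
- move=> U CU; have := Cab U CU; rewrite (fin U CU) !lee_fin => -[aU Ub].
  by apply/andP; split; exact: ler_wpM2l.
Qed.

(** The [a]-neighbourhood of a set of diameter [r >= a] lies in a ball of radius
    [2 * r], and boundedly many sets of diameter at most [r] cover that ball:
    thickening a cover by its smallest diameter costs only a factor. *)
Lemma has_cover_fatten : exists2 M : R, 0 <= M & forall a b s A P, 0 < a ->
  has_cover a b s A P ->
  has_cover a b s (M%:E * A) [set z | exists2 p, P p & enorm (z - p) <= a].
Proof.
have [J [W [finJ cubeW W1]]] := compact_finite_cover ltr01 (@cube_compact R d 2).
exists (fine (\esum_(i in J) 1%:E : \bar R)%E).
  by apply: fine_ge0; exact: esum_ge0.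
move=> a b s A P a0 [C [[cC PC] Cab CA]].
pose r U := fine (diam U).
have fin U : C U -> diam U = (r U)%:E by move=> /Cab[_ /diam_fin].
have Ua U : C U -> a <= r U by move=> CU; have [+ _] := Cab U CU; rewrite fin.
have /choice[u uP] : forall U : set 'rV[R]_d, exists u, U !=set0 -> U u.
  move=> U; have [[u Uu]|?] := pselect (U !=set0); first by exists u.
  by exists 0.
apply: (@has_cover_widen a b s
  (\esum_(k in C `*`` (fun=> J)) (r k.1 `^ s)%:E)
  [set z | exists2 p, P p & enorm (z - p) <= a]) => //.
  rewrite -(@esum_esum _ _ _ C (fun=> J) (fun U _ => (r U `^ s)%:E)); last first.
    by move=> *; rewrite lee_fin powR_ge0.
  apply: (@le_trans _ _
    ((fine (\esum_(i in J) 1%:E : \bar R))%:E * diam_sum s C)%E); last first.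
    by rewrite lee_wpmul2l// lee_fin fine_ge0//; exact: esum_ge0.
  apply: le_trans (esumZl_le _ _ _); last 2 first.
  - by apply: fine_ge0; exact: esum_ge0.
  - by move=> U; exact: poweR_ge0.
  apply: le_esum => U CU; rewrite fin// poweR_EFin muleC fineK; last first.
    exact: esum1_fin_num.
  apply: le_trans (esumZl_le _ _ _) => //; last exact: powR_ge0.
  by apply: le_esum => i _; rewrite mule1.
apply: (@has_cover_family _ (C `*`` (fun=> J))
  (fun k => [set z | W k.2 ((r k.1)^-1 *: (z - u k.1))])).
- by apply: countableXR => // U _; exact: finite_set_countable.
- move=> z [p /PC[U CU Up] zp].
  have rU0 : 0 < r U by rewrite (lt_le_trans a0)// Ua.
  have Uoo : (diam U < +oo)%E by rewrite fin// ltry.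
  have [|i Ji Wi] := cubeW ((r U)^-1 *: (z - u U)); last by exists (U, i).
  apply: enorm_le_cube; rewrite enormZ ger0_norm ?invr_ge0 ?(ltW rU0)//.
  rewrite ler_pdivrMl// mulrDr mulr1.
  apply: le_trans (enorm_triangle p _ _) _; apply: lerD.
    exact: le_trans zp (Ua U CU).
  by apply: enorm_le_diam => //; apply: uP; exists p.
- move=> [U i] [/= CU Ji]; have rU0 : 0 < r U by rewrite (lt_le_trans a0)// Ua.
  have /diam_leP[_ Wi] := W1 i; apply/diam_leP; split; first exact: ltW.
  move=> x y /Wi Wx /Wx; rewrite -scalerBr opprB addrA subrK enormZ.
  by rewrite ger0_norm ?invr_ge0 ?(ltW rU0)// ler_pdivrMl// mulr1.
- move=> [U i] [/= CU Ji]; have [] := Cab U CU.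
  by rewrite fin// !lee_fin => -> ->.
Qed.

End Covers.

(** * Words, Lipschitz constants and cylinders *)

Section WordMaps.
Context {R : realType} {d : nat} {X : set 'rV[R]_d} {I : Type}.
Variable S : I -> X -> X.
Hypothesis HS : is_IIFS S.
Implicit Types (sigma : X -> X) (w u v : seq I) (m n : nat).

Lemma IIFS_dim_gt0 : (0 < d)%N.
Proof.
have [_ _ [x [y [_ _ xy]]] _ _] := HS.
rewrite lt0n; apply/negP => /eqP d0; apply: xy; apply/rowP => i.
by have := ltn_ord i; rewrite [X in (_ < X)%N]d0.
Qed.

Lemma comp_word_cat u v : comp_word S (u ++ v) = comp_word S u \o comp_word S v.
Proof. by elim: u => //= i u ->. Qed.

Lemma cylinder_cat u v : cylinder S (u ++ v) `<=` cylinder S u.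
Proof.
by move=> _ [x _ <-]; rewrite comp_word_cat; exists (comp_word S v x).
Qed.

Lemma countable_word_maps n : countable (word_maps S n).
Proof.
have [_ _ _ cI _] := HS; elim: n => [|n IHn].
  apply: (@sub_countable _ _ _ [set comp_word S [::]]); last exact: countable1.
  by apply: subset_card_le => _ [w /size0nil -> <-].
apply: (@sub_countable _ _ _
    ((fun p => S p.1 \o p.2) @` ([set: I] `*` word_maps S n))).
  apply: subset_card_le => _ [[//|i w] [wn] <-].
  by exists (i, comp_word S w) => //; split => //; exists w.
apply: sub_countable (card_image_le _ _) _; exact: countableX.
Qed.

(** A contraction ratio common to all the maps; being positive, it allows
    scales to be compared with its powers. *)
Lemma comp_word_contract : exists2 rho : R, 0 < rho < 1 &
  forall w (x y : X), enorm (val (comp_word S w x) - val (comp_word S w y))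
    <= rho ^+ size w * enorm (val x - val y).
Proof.
have [_ _ _ _ [rho [/andP[rho0 rho1] Srho]]] := HS.
exists (Num.max rho (1 / 2)); first by rewrite lt_max gt_max rho1; lra.
elim=> [|i w IHw] x y /=; first by rewrite expr0 mul1r.
apply: le_trans (Srho _ _ _) _; rewrite exprS -mulrA.
by apply: ler_pM; rewrite ?enorm_ge0// le_max lexx.
Qed.

Lemma X_two_points : exists x y : X, x <> y.
Proof.
have [_ _ [x [y [Xx Xy xy]]] _ _] := HS.
by exists (SigSub (mem_set Xx)), (SigSub (mem_set Xy)) => -[].
Qed.

Lemma enorm_val_gt0 (x y : X) : x <> y -> 0 < enorm (val x - val y).
Proof.
by move=> xy; apply: enorm_gt0; rewrite subr_eq0; apply/eqP => /val_inj.
Qed.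

Lemma lip_le sigma (c : R) :
  (forall x y, enorm (val (sigma x) - val (sigma y)) <= c * enorm (val x - val y)) ->
  lip sigma <= c.
Proof.
move=> sc; apply: ge_sup.
  by have [x [y xy]] := X_two_points; eexists; exists x, y.
move=> _ [x [y [xy ->]]]; rewrite ler_pdivrMr//; exact: enorm_val_gt0.
Qed.

Lemma lipP sigma (c : R) :
  (forall x y, enorm (val (sigma x) - val (sigma y)) <= c * enorm (val x - val y)) ->
  forall x y, enorm (val (sigma x) - val (sigma y)) <=
    lip sigma * enorm (val x - val y).
Proof.
move=> sc x y; have [->|xy] := pselect (x = y).
  by rewrite !subrr enorm0 mulr0.
rewrite -ler_pdivrMr ?enorm_val_gt0//; apply: sup_upper_bound; last by exists x, y.
split; first by eexists; exists x, y.
by exists c => _ [x' [y' [xy' ->]]]; rewrite ler_pdivrMr// enorm_val_gt0.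
Qed.

Lemma lip_ge0 sigma (c : R) :
  (forall x y, enorm (val (sigma x) - val (sigma y)) <= c * enorm (val x - val y)) ->
  0 <= lip sigma.
Proof.
move=> /lipP sl; have [x [y xy]] := X_two_points.
rewrite -(@pmulr_lge0 _ (enorm (val x - val y))) ?enorm_val_gt0//.
exact: le_trans (enorm_ge0 _) (sl x y).
Qed.

(** The unions of the cylinders of each length contain the limit set and satisfy
    the recursion [level_setD] merely because words concatenate. The inclusion of
    the limit set in the union of its own images would instead need a compactness
    argument, as the maps may fail to be injective. *)
Definition level_set m : set 'rV[R]_d :=
  \bigcup_(w in [set w : seq I | size w = m]) cylinder S w.

Lemma limit_set_level m : limit_set S `<=` level_set m.
Proof.
move=> x [w _ xw]; case: m => [|m].
  exists [::] => //; have [y _ <-] := xw 1%N isT.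
  by exists (comp_word S (mkseq w 1) y).
by exists (mkseq w m.+1); [exact: size_mkseq|exact: xw].
Qed.

Lemma level_setD n m x : level_set (n + m) x ->
  exists2 u, size u = n &
    ((val \o comp_word S u) @` [set y | level_set m (val y)]) x.
Proof.
move=> [w /= wnm [y _ <-]]; exists (take n w).
  by rewrite size_take_min wnm; apply/minn_idPl/leq_addr.
exists (comp_word S (drop n w) y).
  exists (drop n w); last by exists y.
  by rewrite /= size_drop wnm addKn.
by rewrite -[in RHS](cat_take_drop n w) comp_word_cat.
Qed.

End WordMaps.

(** * Contraction of sums along the levels *)

Section Recursion.
Context {R : realType} {d : nat} {X : set 'rV[R]_d} {I : Type}.
Variable S : I -> X -> X.
Hypothesis HS : is_IIFS S.
Implicit Types (sigma : X -> X) (w u v : seq I) (m n k : nat).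

Let d_gt0 : (0 < d)%N := IIFS_dim_gt0 HS.

Lemma word_maps_lip : exists2 rho : R, 0 < rho < 1 &
  forall n sigma, word_maps S n sigma ->
    [/\ 0 <= lip sigma, lip sigma <= rho ^+ n & forall x y,
      enorm (val (sigma x) - val (sigma y)) <= lip sigma * enorm (val x - val y)].
Proof.
have [rho rho01 Sw] := comp_word_contract HS; exists rho => //.
have rho0 : 0 <= rho by case/andP: rho01 => /ltW.
move=> n _ [w <- <-]; split.
- exact: (lip_ge0 HS (Sw w)).
- by apply: (lip_le HS); exact: Sw.
- exact: lipP (Sw w).
Qed.

Lemma phi_ge0 n s : (0 <= phi S n s)%E.
Proof. by apply: esum_ge0 => sigma _; rewrite lee_fin powR_ge0. Qed.

Lemma esum_lip_le n s c : 0 <= c ->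
  (\esum_(sigma in word_maps S n) (lip sigma `^ s * c)%:E <= c%:E * phi S n s)%E.
Proof.
move=> c0; under eq_esum do rewrite mulrC EFinM.
by apply: esumZl_le => // sigma; rewrite lee_fin powR_ge0.
Qed.

Lemma has_cover_level0 s : exists2 D : R, 0 < D &
  has_cover 0 D s (D `^ s)%:E (level_set S 0).
Proof.
have [cX _ _ _ _] := HS; have [D D0 XD] := compact_enorm_bounded cX.
exists D => //.
have := @has_cover_family R d d_gt0 _ [set tt] (fun=> X) (fun=> D) 0 D s
  (level_set S 0) (countable1 tt).
rewrite esum_set1 ?lee_fin ?powR_ge0//; apply.
- by move=> _ [w _ [x _ <-]]; exists tt => //; exact: set_valP.
- by move=> _ _; apply/diam_leP; split; [exact: ltW|].
- by move=> _ _; rewrite (ltW D0)/=.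
Qed.

(** Iterating the cover of the limit set by the sets [sigma X], [sigma] in
    [word_maps S n], multiplies the sum by at most [phi S n s] each time. *)
Lemma has_cover_level_small n s : exists2 rho : R, 0 < rho < 1 &
  exists2 D : R, 0 < D & forall q k, (phi S n s <= q%:E)%E ->
  has_cover 0 (D * (rho ^+ n) ^+ k) s (D `^ s * q ^+ k)%:E (level_set S (n * k)).
Proof.
have [rho rho01 lipw] := word_maps_lip.
have [D D0 X0] := has_cover_level0 s; exists rho => //; exists D => // q k phiq.
have q0 : 0 <= q by rewrite -lee_fin (le_trans (phi_ge0 _ _) phiq).
have Ds0 : 0 <= D `^ s by exact: powR_ge0.
elim: k => [|k IHk]; first by rewrite muln0 !expr0 !mulr1.
have /andP[rho0 rho1] := rho01.
have cover sigma : word_maps S n sigma ->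
    has_cover 0 (D * (rho ^+ n) ^+ k.+1) s
      (lip sigma `^ s * (D `^ s * q ^+ k))%:E
      ((val \o sigma) @` [set y | level_set S (n * k) (val y)]).
  move=> /lipw[l0 lr sl]; rewrite EFinM.
  apply: has_cover_widen (has_cover_image d_gt0 l0 sl IHk); rewrite ?mulr0//.
  rewrite mulrCA exprS; apply: ler_wpM2l; first exact: ltW.
  by apply: ler_wpM2r => //; do 2 apply: exprn_ge0; exact: ltW.
apply: has_cover_widen (has_cover_bigcup (countable_word_maps HS n) cover) => //.
- apply: le_trans (esum_lip_le _ _ _) _; first by rewrite mulr_ge0 ?exprn_ge0.
  rewrite exprSr mulrA [in leRHS]EFinM; apply: lee_wpmul2l => //.
  by rewrite lee_fin mulr_ge0 ?exprn_ge0.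
- move=> x; rewrite mulnS => /level_setD[u un xu].
  by exists (comp_word S u) => //; exists u.
Qed.

End Recursion.

(** * Covers of the limit set *)

Section Core.
Context {R : realType} {d : nat} {X : set 'rV[R]_d} {I : Type}.
Variable S : I -> X -> X.
Hypothesis HS : is_IIFS S.
Implicit Types (sigma : X -> X) (w u v : seq I) (m n k : nat).

Let d_gt0 : (0 < d)%N := IIFS_dim_gt0 HS.

(** [X] splits into finitely many pieces of diameter at most [eta], and their
    images under a [c]-Lipschitz map fit into sets of any diameter
    [e >= c * eta]; the number [N] of pieces serves all maps at once. *)
Lemma has_cover_cylinder (eta : R) : 0 < eta ->
  exists2 N : R, 0 <= N & forall sigma (c e a b s : R), 0 <= c -> a <= e <= b ->
    c * eta <= e ->
    (forall x y, enorm (val (sigma x) - val (sigma y)) <= c * enorm (val x - val y)) ->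
    has_cover a b s (N * e `^ s)%:E (range (val \o sigma)).
Proof.
move=> eta0; have [cX _ _ _ _] := HS.
have [J [W [finJ XW Weta]]] := compact_finite_cover eta0 cX.
have N0 : (0 <= \esum_(i in J) 1%:E :> \bar R)%E by exact: esum_ge0.
exists (fine (\esum_(i in J) 1%:E : \bar R)%E); first exact: fine_ge0.
move=> sigma c e a b s c0 aeb ce sc.
apply: (@has_cover_widen _ _ a b s (\esum_(i in J) (e `^ s)%:E)
  (range (val \o sigma))) => //.
  rewrite mulrC EFinM fineK ?esum1_fin_num//; apply: le_trans (esumZl_le _ _ _) => //.
  - by apply: le_esum => i _; rewrite mule1.
  - exact: powR_ge0.
apply: (@has_cover_family _ _ d_gt0 _ J
  (fun i => (val \o sigma) @` [set x | W i (val x)]) (fun=> e)) => //.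
- exact: finite_set_countable.
- move=> _ [x _ <-]; have [i Ji Wx] := XW _ (set_valP x).
  by exists i => //; exists x.
- move=> i _; have /diam_leP[_ Wi] := Weta i; apply/diam_leP; split.
    by apply: le_trans ce; rewrite mulr_ge0// ltW.
  move=> _ _ [x Wx <-] [y Wy <-]; apply: le_trans (sc _ _) _.
  by apply: le_trans ce; rewrite ler_wpM2l//; exact: Wi.
Qed.

(** The bound [A] solves [c + (K + A) * phi S n s <= A], which is possible because
    [phi S n s < 1]. The three terms are the costs, at scale [delta], of the three
    kinds of maps [sigma] in [word_maps S n]. If [lip sigma * D <= Phi delta], the
    image of [X] is near [P], and all of these are covered together for [c] by
    thickening a cover of [P]. If it is larger but [lip sigma * eta <= delta],
    boundedly many sets of diameter comparable to [lip sigma] cover the image.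
    Otherwise a cover at the larger scale [delta / lip sigma] is transported by
    [sigma]; its diameters are still at least [Phi delta] because
    [Phi delta / delta] is nondecreasing. As [lip sigma <= rho], the scale grows
    by a factor of at least [rho^-1], which is what the induction on [k] uses. *)
Lemma has_cover_limit_set (Delta : R) (Phi : R -> R) (s : R) n P (delta1 B : R) :
  0 < Delta ->
  (forall delta, 0 < delta < Delta -> 0 < Phi delta <= delta) ->
  {in `]0, Delta[ &, {homo (fun delta => Phi delta / delta) : x y / x <= y}} ->
  0 < s -> (0 < n)%N -> (phi S n s < 1)%E -> hitting_sets S n P ->
  0 < delta1 -> 0 <= B ->
  (forall delta, 0 < delta < delta1 -> delta < Delta ->
     has_cover (Phi delta) delta s B%:E P) ->
  exists2 eta : R, 0 < eta & exists A : R, forall delta, 0 < delta < eta ->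
    delta < Delta -> has_cover (Phi delta) delta s A%:E (limit_set S).
Proof.
move=> Delta0 PhiP Phimono s0 n0 phi1 [_ Phit] delta10 B0 Pcov.
have [cX _ _ _ _] := HS; have [D D0 XD] := compact_enorm_bounded cX.
have [rho /andP[rho0 rho1] lipw] := word_maps_lip HS.
pose eta := Num.min Delta (Num.min delta1 D).
have eta0 : 0 < eta by rewrite !lt_min Delta0 delta10.
have etaDelta delta : delta < eta -> delta < Delta by rewrite lt_min => /andP[].
have etadelta1 delta : delta < eta -> delta < delta1.
  by rewrite !lt_min => /and3P[].
have etaD : eta <= D by rewrite !ge_min lexx !orbT.
have [N N0 cylN] := has_cover_cylinder eta0.
have phifin : phi S n s \is a fin_num.
  by rewrite ge0_fin_numE ?phi_ge0// (lt_trans phi1)// ltry.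
pose q := fine (phi S n s).
have phiq : phi S n s = q%:E by rewrite fineK.
have q0 : 0 <= q by exact/fine_ge0/phi_ge0.
have q1 : q < 1 by rewrite -lte_fin -phiq.
have [M M0 fatten] := @has_cover_fatten R d d_gt0.
pose K := N * D `^ s; pose c := M * B.
have K0 : 0 <= K by rewrite mulr_ge0 ?powR_ge0.
have c0 : 0 <= c by rewrite mulr_ge0.
pose A := (c + K) / (1 - q).
have A0 : 0 <= A by apply: divr_ge0; [exact: addr_ge0|rewrite subr_ge0 ltW].
have cKA : c + (K + A) * q <= A.
  have -> : c + (K + A) * q = c + K * q + A * q by rewrite mulrDl addrA.
  rewrite -lerBrDr -[X in X - _]mulr1 -mulrBr /A divfK; last first.
    by rewrite gt_eqF// subr_gt0.
  by rewrite lerD2l ler_piMr// ltW.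
(* The constant [A] must not depend on [k], since every [delta] eventually
   exceeds [rho ^+ k * eta]. *)
have main k : forall delta, 0 < delta < eta -> rho ^+ k * eta <= delta ->
    has_cover (Phi delta) delta s A%:E (level_set S (n * k)).
  elim: k => [|k IHk] delta /andP[delta0 deltaeta].
    by rewrite expr0 mul1r leNgt deltaeta.
  move=> rhodelta.
  have deltaD := etaDelta _ deltaeta.
  have /andP[Phi0 Phidelta] : 0 < Phi delta <= delta by rewrite PhiP// delta0.
  pose small sigma := lip sigma * D <= Phi delta.
  pose E sigma : set 'rV[R]_d := if small sigma then set0 else
    (val \o sigma) @` [set x | level_set S (n * k) (val x)].
  have Ecov sigma : word_maps S n sigma ->
      has_cover (Phi delta) delta s (lip sigma `^ s * (K + A))%:E (E sigma).
    move=> Msigma; have [l0 lrho sl] := lipw _ _ Msigma.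
    have {}lrho : lip sigma <= rho.
      apply: le_trans lrho _; rewrite -{2}(expr1 rho).
      by rewrite ler_wiXn2l ?ltW.
    rewrite /E; have [_|/negP/negP] := boolP (small sigma).
      by apply: has_cover_set0; rewrite lee_fin mulr_ge0 ?powR_ge0 ?addr_ge0.
    rewrite /small -ltNge => big.
    have lgt0 : 0 < lip sigma.
      rewrite lt_neqAle l0 andbT; apply/eqP => l00.
      by move: big; rewrite -l00 mul0r ltNge ltW.
    have [le_delta|gt_delta] := leP (lip sigma * eta) delta.
      (* Capping by [delta] keeps [e] in the window without enlarging the sum. *)
      pose e := Num.min (lip sigma * D) delta.
      have e0 : 0 < e by rewrite lt_min delta0 !mulr_gt0.
      apply: (has_cover_widen (lexx _) (lexx _)); last first.
      - apply: (cylN sigma (lip sigma) e) => //.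
        + by rewrite le_min (ltW big) Phidelta/= ge_min lexx orbT.
        + by rewrite le_min le_delta andbT ler_wpM2l.
      - by move=> _ [x _ <-]; exists x.
      - rewrite lee_fin (@le_trans _ _ (lip sigma `^ s * K))//; last first.
          by rewrite ler_wpM2l ?powR_ge0// lerDl.
        rewrite /K mulrCA ler_wpM2l// -powRM// ?mulr_ge0 ?(ltW D0)//.
        rewrite ge0_ler_powR ?nnegrE ?mulr_ge0 ?(ltW D0) ?(ltW s0) ?(ltW e0)//.
        by rewrite ge_min lexx.
    pose delta' := delta / lip sigma.
    have dd : delta <= delta'.
      by rewrite ler_pdivlMr// ler_piMr ?(ltW delta0)// (le_trans lrho)// ltW.
    have delta'0 : 0 < delta' by rewrite divr_gt0.
    have delta'eta : delta' < eta by rewrite ltr_pdivrMr// mulrC.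
    have delta'D := etaDelta _ delta'eta.
    have cov' : has_cover (Phi delta') delta' s A%:E (level_set S (n * k)).
      apply: IHk; first by rewrite delta'0.
      rewrite ler_pdivlMr// (le_trans _ rhodelta)// exprSr mulrAC.
      by rewrite ler_pM2r ?ler_wpM2l ?exprn_ge0 ?(ltW rho0).
    apply: has_cover_widen (has_cover_image d_gt0 l0 sl cov').
    + have := Phimono delta delta'; rewrite !in_itv/= delta0 delta'0 deltaD.
      move=> /(_ isT delta'D dd); rewrite ler_pdivlMr//.
      by rewrite /delta' mulrA -ler_pdivlMr ?invr_gt0// invrK mulfVK ?gt_eqF// mulrC.
    + by rewrite /delta' mulrC divfK ?gt_eqF.
    + by rewrite -EFinM lee_fin ler_wpM2l ?powR_ge0// lerDr.
    + by [].
  have deltadelta1 : 0 < delta < delta1 by rewrite delta0 etadelta1.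
  have Gcov := fatten _ _ _ _ _ Phi0 (Pcov delta deltadelta1 deltaD).
  have Mcov := has_cover_bigcup (countable_word_maps HS n) Ecov.
  apply: has_cover_widen (has_coverU _ _ Gcov Mcov) => //.
  - apply: (@le_trans _ _ (c%:E + (K + A)%:E * phi S n s)%E).
      by rewrite EFinM leeD2l// esum_lip_le// addr_ge0.
    by rewrite phiq -EFinM -EFinD lee_fin.
  - move=> x; rewrite mulnS => /level_setD[u un xu].
    have [smallu|bigu] := boolP (small (comp_word S u)); last first.
      by right; exists (comp_word S u); [exists u|rewrite /E (negbTE bigu)].
    have [p [Pp [y _ py]]] := Phit u un.
    have [l0 _ sl] : _ := lipw n (comp_word S u) (ex_intro2 _ _ u un erefl).
    left; exists p => //; case: xu => z _ <-; rewrite -py.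
    apply: le_trans (sl z y) _; apply: le_trans smallu; rewrite ler_wpM2l//.
    by apply: XD; exact: set_valP.
  - by apply: esum_ge0 => sigma _; rewrite lee_fin mulr_ge0 ?powR_ge0 ?addr_ge0.
exists eta => //; exists A => delta /andP[delta0 deltaeta] _.
have rho01 : 0 <= rho < 1 by rewrite rho1 ltW.
have [k _ /(_ k (leqnn k))] := exprn_small rho01 (divr_gt0 delta0 eta0).
rewrite /= ltr_pdivlMr// => /ltW /(main k delta); rewrite delta0 => /(_ deltaeta).
by apply: has_cover_widen => //; exact: limit_set_level.
Qed.

End Core.

(** * From covers to dimensions *)

Section DimensionsFromCovers.
Context {R : realType} {d : nat}.
Implicit Types (E P : set 'rV[R]_d) (Phi : R -> R) (s t : R).

Lemma lee_of_lt_EFin (x y : \bar R) :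
  (forall s, (y < s%:E)%E -> (x <= s%:E)%E) -> (x <= y)%E.
Proof.
case: y => [y| |] H; last 2 first.
- exact: leey.
- case: x H => [x| |] H //=; last by have := H 0 (ltNyr _).
  by have := H (x - 1)%R (ltNyr _); rewrite lee_fin lerBrDr gerDl ler10.
by apply/lee_addgt0Pr => e e0; rewrite -EFinD H// lte_fin ltrDl.
Qed.

(** Raising the exponent gains a power of the largest diameter. The members are
    required to have positive diameter because [0 `^ 0 = 1]. *)
Lemma has_cover_exponent (a b s t : R) (A : R) E : 0 < a -> 0 < b -> s <= t ->
  has_cover a b s A%:E E -> has_cover a b t (b `^ (t - s) * A)%:E E.
Proof.
move=> a0 b0 st [C [cC Cab CA]]; exists C; split => //.
rewrite EFinM; apply: (@le_trans _ _ ((b `^ (t - s))%:E * diam_sum s C)%E).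
  apply: le_trans (esumZl_le _ _ _); last 2 first.
  - exact: powR_ge0.
  - by move=> U; exact: poweR_ge0.
  apply: le_esum => U /Cab[]; case: (diam U) => [r||]//; rewrite !lee_fin => ar rb.
  have r0 : 0 < r by exact: lt_le_trans ar.
  rewrite -[in leLHS](subrK s t) (@powRD _ r); last first.
    by rewrite (gt_eqF r0) implybT.
  apply: ler_wpM2r; first exact: powR_ge0.
  by rewrite ge0_ler_powR ?nnegrE ?subr_ge0 ?(ltW r0) ?(ltW b0).
by rewrite lee_wpmul2l// lee_fin powR_ge0.
Qed.

Lemma has_cover_small (Delta : R) Phi s t (eta A eps : R) E :
  (forall delta, 0 < delta < Delta -> 0 < Phi delta) ->
  0 < eta -> (forall delta, 0 < delta < eta -> delta < Delta ->
    has_cover (Phi delta) delta s A%:E E) ->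
  s < t -> 0 < eps ->
  exists2 delta0, 0 < delta0 <= 1 & forall delta, 0 < delta < delta0 ->
    delta < Delta -> has_cover (Phi delta) delta t eps%:E E.
Proof.
move=> Phi0 eta0 Ecov st eps0.
have ts0 : 0 < t - s by rewrite subr_gt0.
have A1 : 0 < `|A| + 1 by rewrite ltr_wpDl.
pose z := (eps / (`|A| + 1)) `^ (t - s)^-1.
have z0 : 0 < z by apply: powR_gt0; exact: divr_gt0.
exists (Num.min 1 (Num.min eta z)).
  by rewrite !lt_min ltr01 eta0 z0/= ge_min lexx.
move=> delta /andP[delta0]; rewrite !lt_min => /and3P[_ deltaeta deltaz] deltaD.
have {}Phi0 : 0 < Phi delta by rewrite Phi0// delta0.
have deta : 0 < delta < eta by rewrite delta0.
have := has_cover_exponent Phi0 delta0 (ltW st) (Ecov _ deta deltaD).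
apply: has_cover_widen => //; rewrite lee_fin.
apply: (@le_trans _ _ (delta `^ (t - s) * (`|A| + 1))).
  by rewrite ler_wpM2l ?powR_ge0// (le_trans (ler_norm _))// lerDl.
rewrite -ler_pdivlMr//.
have -> : eps / (`|A| + 1) = z `^ (t - s).
  by rewrite /z -powRrM mulVf ?gt_eqF// powRr1// divr_ge0// ltW.
by rewrite ge0_ler_powR ?nnegrE// ltW.
Qed.

Lemma upper_Phi_dim_le (Delta : R) Phi s E : 0 <= s ->
  (forall delta, 0 < delta < Delta -> 0 < Phi delta) ->
  (exists2 eta : R, 0 < eta & exists A : R, forall delta, 0 < delta < eta ->
    delta < Delta -> has_cover (Phi delta) delta s A%:E E) ->
  (upper_Phi_dim Delta Phi E <= s%:E)%E.
Proof.
move=> s0 Phi0 [eta eta0 [A Ecov]]; apply: lee_of_lt_EFin => t; rewrite lte_fin => st.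
apply: ereal_inf_lbound; exists t => //; split; first by rewrite (le_trans s0)// ltW.
move=> eps eps0.
have [delta0 /andP[d0 d1] H] := has_cover_small Phi0 eta0 Ecov st eps0.
exists delta0; split => // delta delta_gt0 deltad deltaD.
by apply: H => //; rewrite delta_gt0.
Qed.

Lemma upper_Phi_dim_lt (Delta : R) Phi s E :
  (forall delta, 0 < delta < Delta -> 0 < Phi delta) ->
  (upper_Phi_dim Delta Phi E < s%:E)%E ->
  exists2 eta : R, 0 < eta & forall delta, 0 < delta < eta ->
    delta < Delta -> has_cover (Phi delta) delta s 1%:E E.
Proof.
move=> Phi0 /ereal_inf_lt[_ [t [t0 tE] <-]]; rewrite lte_fin => ts.
have [eta [eta0 eta1 H]] := tE 1 ltr01; exists eta => //.
move=> delta /andP[delta0 deltaeta] deltaD.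
have {}H : has_cover (Phi delta) delta t 1%:E E by exact: H.
have Phid : 0 < Phi delta by rewrite Phi0// delta0.
apply: has_cover_widen (has_cover_exponent Phid delta0 (ltW ts) H) => //.
rewrite lee_fin mulr1 -[leRHS](powRr0 delta) ger_powR ?subr_ge0 ?(ltW ts)//.
by rewrite delta0 (le_trans _ eta1)// ltW.
Qed.

Hypothesis d_gt0 : (0 < d)%N.

Lemma esum1_ord n : (\esum_(i in [set: 'I_n]) 1%:E = n%:R%:E :> \bar R)%E.
Proof.
have -> : [set: 'I_n] = [set` enum 'I_n].
  by apply/seteqP; split => // i _; rewrite /= mem_enum.
rewrite esum_fset// -fsbig_seq ?enum_uniq//= big_enum/= sumEFin.
by rewrite sumr_const card_ord.
Qed.

Lemma upper_box_dim_lt s E : (upper_box_dim E < s%:E)%E ->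
  exists2 eta : R, 0 < eta & forall delta, 0 < delta < eta ->
    delta < 1 -> has_cover delta delta s 1%:E E.
Proof.
move=> /ereal_inf_lt[_ [V V0 <-] Vs].
move/nbhs_ballP : V0 => [eta /= eta0 etaV]; exists eta => // delta.
move=> /andP[delta0 deltaeta] delta1.
have Vdelta : V delta.
  by apply: etaV => //; rewrite -ball_normE/= sub0r normrN gtr0_norm.
have ln0 : 0 < - ln delta by rewrite oppr_gt0 ln_lt0// delta0.
have {}Vs : (lne (covering_number delta E) * ((- ln delta)^-1)%:E < s%:E)%E.
  by apply: le_lt_trans Vs; apply: ereal_sup_ubound; exists delta.
have ps0 : 0 < delta `^ - s by exact: powR_gt0.
have /ereal_inf_lt[_ [n [U [EU Ud]] <-]] :
    (covering_number delta E < (delta `^ - s)%:E)%E.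
  rewrite ltNge; apply/negP => Ns; move: Vs; apply/negP; rewrite -leNgt.
  have {}Ns : (lne (delta `^ - s)%:E <= lne (covering_number delta E))%E.
    rewrite (@lee_lne R) ?in_itv/= ?leey ?andbT ?lee_fin ?powR_ge0//.
    by apply: le_trans Ns; rewrite lee_fin ltW.
  rewrite lne_EFin// ln_powR in Ns.
  apply: le_trans (lee_wpmul2r _ Ns); last by rewrite lee_fin invr_ge0 ltW.
  by rewrite -EFinM lee_fin mulNr -mulrN mulfK// gt_eqF.
rewrite lte_fin => nd.
have := @has_cover_family _ _ d_gt0 _ [set: 'I_n] U (fun=> delta) delta delta s E
  (countableP _) EU.
move=> /(_ (fun i _ => Ud i)); rewrite lexx => /(_ (fun _ _ => isT)).
apply: has_cover_widen => //.
apply: (@le_trans _ _ ((delta `^ s)%:E * \esum_(i in [set: 'I_n]) 1%:E)%E).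
  apply: le_trans (esumZl_le _ _ _) => //; last exact: powR_ge0.
  by apply: le_esum => i _; rewrite mule1.
rewrite esum1_ord -EFinM lee_fin -ler_pdivlMl ?powR_gt0// mulr1 -powRN.
exact: ltW.
Qed.

(** All members of the cover have diameter [delta], so the sum is [delta `^ s]
    times their number, which forces the cover to be finite. *)
Lemma covering_number_le (delta s A : R) E : 0 < delta ->
  has_cover delta delta s A%:E E ->
  (covering_number delta E <= (A / delta `^ s)%:E)%E.
Proof.
move=> delta0 [C [[cC EC] Cd CA]].
have ds0 : 0 < delta `^ s by exact: powR_gt0.
have diamC U : C U -> diam U = delta%:E.
  by move=> /Cd[dU Ud]; apply/eqP; rewrite eq_le dU Ud.
have sub (B : {fset (set 'rV[R]_d)}) : [set` B] `<=` C ->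
    #|` B|%:R <= A / delta `^ s.
  move=> BC; rewrite ler_pdivlMr// -lee_fin; apply: le_trans CA.
  apply: esum_ge; exists [set` B]; first by split.
  rewrite (eq_fsbigr (fun=> (delta `^ s)%:E)); last first.
    by move=> U /set_mem/BC/diamC ->; rewrite poweR_EFin.
  rewrite fsbig_finite//= set_fsetK sumEFin lee_fin.
  by rewrite big_const_seq count_predT iter_addr addr0 mulr_natl.
have finC : finite_set C.
  apply: contrapT => /(infinite_set_fset (Num.truncn (A / delta `^ s)).+1)[B BC].
  move=> nB; have := sub B BC; apply/negP; rewrite -ltNge.
  by apply: lt_le_trans (truncnS_gt _) _; rewrite ler_nat.
apply: (@le_trans _ _ (#|` fset_set C|%:R)%:E); last first.
  by rewrite lee_fin; apply: sub; rewrite fset_setK.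
apply: ereal_inf_lbound; exists #|` fset_set C| => //.
exists (fun i => nth set0 (fset_set C) i); split.
  move=> x /EC[U CU Ux].
  have UC : U \in fset_set C by rewrite in_fset_set// mem_set.
  have iU : (index U (fset_set C) < #|` fset_set C|)%N by rewrite index_mem.
  by exists (Ordinal iU) => //=; rewrite nth_index.
move=> i; have : nth set0 (fset_set C) i \in fset_set C by exact: mem_nth.
by rewrite in_fset_set// => /set_mem/diamC ->.
Qed.

Lemma upper_box_dim_le s E :
  (exists2 eta : R, 0 < eta & exists A : R, forall delta, 0 < delta < eta ->
    delta < 1 -> has_cover delta delta s A%:E E) ->
  (upper_box_dim E <= s%:E)%E.
Proof.
move=> [eta eta0 [A Ecov]]; apply: lee_of_lt_EFin => t; rewrite lte_fin => st.
have id0 : forall delta : R, 0 < delta < 1 -> 0 < delta by move=> x /andP[].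
have [delta0 /andP[d0 d1] H] := has_cover_small id0 eta0 Ecov st ltr01.
apply: (@le_trans _ _ (ereal_sup [set (lne (covering_number delta E) *
    ((- ln delta)^-1)%:E)%E | delta in `]0, delta0[])).
  apply: ereal_inf_lbound; exists `]0, delta0[%classic => //.
  apply/nbhs_ballP; exists delta0 => //= delta.
  rewrite -ball_normE/= sub0r normrN => dd delta_gt0.
  by rewrite in_itv/= delta_gt0 -(gtr0_norm delta_gt0).
apply: ge_ereal_sup => _ [delta + <-]; rewrite /= in_itv/= => dd.
have /andP[delta_gt0 deltad] := dd.
have delta1 : delta < 1 by exact: lt_le_trans d1.
have ln0 : 0 < - ln delta by rewrite oppr_gt0 ln_lt0// delta_gt0.
have := covering_number_le delta_gt0 (H _ dd delta1); rewrite div1r -powRN => N.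
have N0 : (0 <= covering_number delta E)%E.
  by apply: le_ereal_inf_tmp => _ [n _ <-]; rewrite lee_fin.
have : (lne (covering_number delta E) <= lne (delta `^ - t)%:E)%E.
  by rewrite (@lee_lne R) ?in_itv/= ?leey ?andbT ?lee_fin ?powR_ge0.
rewrite lne_EFin ?powR_gt0// ln_powR => lnN.
apply: le_trans (lee_wpmul2r _ lnN) _; first by rewrite lee_fin invr_ge0 ltW.
by rewrite -EFinM lee_fin mulNr -mulrN mulfK// gt_eqF.
Qed.

End DimensionsFromCovers.

(** * Dimensions of the limit set *)

Section Assembly.
Context {R : realType} {d : nat} {X : set 'rV[R]_d} {I : Type}.
Variable S : I -> X -> X.
Hypothesis HS : is_IIFS S.
Implicit Types (s : R) (dim : set 'rV[R]_d -> \bar R).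

Let d_gt0 : (0 < d)%N := IIFS_dim_gt0 HS.

Lemma h_exponent_ge0 : (0 <= h_exponent S)%E.
Proof. by apply: le_ereal_inf_tmp => _ [t [t0 _] <-]; rewrite lee_fin ltW. Qed.

Lemma h_exponent_lt s : (h_exponent S < s%:E)%E ->
  0 < s /\ exists2 n, (0 < n)%N & (phi S n s < 1)%E.
Proof.
move=> /ereal_inf_lt[_ [t [t0 Pt] <-]]; rewrite lte_fin => ts.
split; first exact: lt_trans ts.
move: Pt => /ereal_inf_lt[_ [n n0 <-]] Hn; exists n => //.
have {Hn} : (lne (phi S n t) < 0)%E.
  move: Hn; apply: contraTT; rewrite -!leNgt => H.
  by rewrite mule_ge0// lee_fin invr_ge0.
rewrite lne_lt0; apply: le_lt_trans.
have [rho /andP[rho0 rho1] lipw] := word_maps_lip HS.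
apply: le_esum => sigma /lipw[l0 lrho _]; rewrite lee_fin.
have [->|lneq0] := eqVneq (lip sigma) 0.
  by rewrite !powR0// gt_eqF// (lt_trans t0).
apply: ger_powR (ltW ts); rewrite lt0r lneq0 l0 (le_trans lrho)//.
by rewrite exprn_ile1// ltW.
Qed.

(** The covers coming from cylinders of length [n * k] suffice: as [k] grows, both
    their diameters and their sums [D `^ s * q ^+ k] tend to 0. *)
Lemma hausdorff_dim_le_h : (hausdorff_dim (limit_set S) <= h_exponent S)%E.
Proof.
apply: lee_of_lt_EFin => s /h_exponent_lt[s0 [n n0 phi1]].
apply: ereal_inf_lbound; exists s => //; split; first exact: ltW.
have [rho /andP[rho0 rho1] [D D0 Lcov]] := has_cover_level_small HS n s.
have phifin : phi S n s \is a fin_num.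
  by rewrite ge0_fin_numE ?phi_ge0// (lt_trans phi1)// ltry.
pose q := fine (phi S n s).
have phiq : phi S n s = q%:E by rewrite fineK.
have q01 : 0 <= q < 1 by rewrite fine_ge0 ?phi_ge0//= -lte_fin -phiq.
have rn01 : 0 <= rho ^+ n < 1 by rewrite exprn_ge0 ?exprn_ilt1 ?ltW// -?lt0n.
have Ds0 : 0 < D `^ s by exact: powR_gt0.
have pre0 (E : set 'rV[R]_d) delta : (0 <= hausdorff_premeasure s delta E)%E.
  by apply: le_ereal_inf_tmp => _ [C _ <-]; apply: esum_ge0 => U _; exact: poweR_ge0.
apply/eqP; rewrite eq_le; apply/andP; split; last first.
  apply: le_trans (pre0 (limit_set S) 1) _.
  by apply: ereal_sup_ubound; exists 1 => //=; exact: ltr01.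
apply: ge_ereal_sup => _ [delta delta0 <-]; apply/lee_addgt0Pr => eps eps0.
rewrite add0e.
have [k1 _ Hk1] := exprn_small rn01 (divr_gt0 delta0 D0).
have [k2 _ Hk2] := exprn_small q01 (divr_gt0 eps0 Ds0).
pose k := maxn k1 k2.
have {}Hk1 : D * (rho ^+ n) ^+ k <= delta.
  by rewrite mulrC -ler_pdivlMr// ltW//; apply: Hk1; exact: leq_maxl.
have {}Hk2 : D `^ s * q ^+ k <= eps.
  by rewrite mulrC -ler_pdivlMr// ltW//; apply: Hk2; exact: leq_maxr.
have [|C [[cC LC] Cd CD]] := Lcov q k; first by rewrite phiq.
apply: (@le_trans _ _ (diam_sum s C)); last first.
  by apply: le_trans CD _; rewrite lee_fin.
apply: ereal_inf_lbound; exists C => //; split.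
  by split => // x /(limit_set_level (n * k))/LC.
by move=> U /Cd[_ UD]; apply: le_trans UD _; rewrite lee_fin.
Qed.

(** With at least one letter, words of length [n] extend to length [n.+1], so the
    infimum over hitting sets is nondecreasing in [n] and its limit bounds each
    of its terms. *)
Lemma lim_hitting_dim_lt dim (x : \bar R) n : inhabited I ->
  (lim_hitting_dim S dim < x)%E ->
  exists2 P, hitting_sets S n P & (dim P < x)%E.
Proof.
move=> [i]; pose u n := ereal_inf [set dim P | P in hitting_sets S n].
have nd : {homo u : m n / (m <= n)%N >-> (m <= n)%E}.
  apply: homo_leq => [//|m|m]; first exact: le_trans.
  apply: ereal_inf_le_tmp => _ [P [PX Phit] <-]; exists P => //; split => // w wm.
  have [|p [Pp /cylinder_cat pw]] := Phit (w ++ [:: i]); last by exists p.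
  by rewrite size_cat wm addn1.
rewrite /lim_hitting_dim -/u (cvg_lim (@ereal_hausdorff R)
  (ereal_nondecreasing_cvgn nd)) => ux.
have : (u n < x)%E by apply: le_lt_trans ux; apply: ereal_sup_ubound; exists n.
by move=> /ereal_inf_lt[_ [P nP <-]]; exists P.
Qed.

(** Any notion of dimension for which dimension below [s] provides covers with
    diameters between [Phi delta] and [delta] and bounded sums of [s]-th powers
    passes from the hitting sets to the limit set. *)
Lemma limit_set_covers (Delta : R) (Phi : R -> R) dim s :
  0 < Delta ->
  (forall delta, 0 < delta < Delta -> 0 < Phi delta <= delta) ->
  {in `]0, Delta[ &, {homo (fun delta => Phi delta / delta) : x y / x <= y}} ->
  (forall P, (dim P < s%:E)%E -> exists2 eta : R, 0 < eta &
    forall delta, 0 < delta < eta -> delta < Delta ->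
      has_cover (Phi delta) delta s 1%:E P) ->
  (maxe (h_exponent S) (lim_hitting_dim S dim) < s%:E)%E ->
  exists2 eta : R, 0 < eta & exists A : R, forall delta, 0 < delta < eta ->
    delta < Delta -> has_cover (Phi delta) delta s A%:E (limit_set S).
Proof.
move=> Delta0 PhiP Phimono dimP; rewrite gt_max => /andP[hs lims].
have [s0 [n n0 phi1]] := h_exponent_lt hs.
(* Without letters there are no infinite words, and the limit set is empty. *)
have [I0|I0] := pselect (inhabited I); last first.
  exists 1 => //; exists 0 => delta _ _.
  apply: has_cover_widen (has_cover_set0 _ _ _ (lexx _)) => //.
  by move=> x [w _ _]; case: I0; exact: inhabits (w 0%N).
have [P nP /dimP[delta1 delta10 Pcov]] := lim_hitting_dim_lt n I0 lims.
exact: (has_cover_limit_set HS Delta0 PhiP Phimono s0 n0 phi1 nP delta10 ler01 Pcov).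
Qed.

Lemma upper_Phi_dim_limit_set (Delta : R) (Phi : R -> R) :
  0 < Delta ->
  (forall delta, 0 < delta < Delta -> 0 < Phi delta <= delta) ->
  {in `]0, Delta[ &, {homo (fun delta => Phi delta / delta) : x y / x <= y}} ->
  (upper_Phi_dim Delta Phi (limit_set S) <=
     maxe (h_exponent S) (lim_hitting_dim S (upper_Phi_dim Delta Phi)))%E.
Proof.
move=> Delta0 PhiP Phimono; apply: lee_of_lt_EFin => s sgt.
have Phi0 delta : 0 < delta < Delta -> 0 < Phi delta by move=> /PhiP/andP[].
apply: upper_Phi_dim_le => //.
  rewrite -lee_fin (le_trans h_exponent_ge0)// ltW// (le_lt_trans _ sgt)//.
  by rewrite le_max lexx.
apply: limit_set_covers sgt => // P; exact: upper_Phi_dim_lt.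
Qed.

Lemma upper_box_dim_limit_set :
  (upper_box_dim (limit_set S) <=
     maxe (h_exponent S) (lim_hitting_dim S upper_box_dim))%E.
Proof.
apply: lee_of_lt_EFin => s sgt; apply: upper_box_dim_le.
apply: (@limit_set_covers 1 id upper_box_dim) => //.
- by move=> delta /andP[-> _] /=.
- move=> x y; rewrite !in_itv/= => /andP[x0 _] /andP[y0 _] _.
  by rewrite !divff ?gt_eqF.
- by move=> P; exact: upper_box_dim_lt.
Qed.

Lemma powR_inv_admissible (theta : R) : 0 < theta <= 1 ->
  (forall delta, 0 < delta < 1 -> 0 < delta `^ theta^-1 <= delta) /\
  {in `]0, 1[ &, {homo (fun delta : R => delta `^ theta^-1 / delta) :
    x y / x <= y}}.
Proof.
move=> /andP[theta0 theta1]; have inv1 : 1 <= theta^-1 by rewrite invf_ge1.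
split=> [delta /andP[d0 d1]|x y].
  by rewrite powR_gt0//= -[leRHS](powRr1 (ltW d0)) ger_powR// d0 ltW.
rewrite !in_itv/= => /andP[x0 _] /andP[y0 _] xy.
have H (z : R) : 0 < z -> z `^ theta^-1 / z = z `^ (theta^-1 - 1).
  by move=> z0; rewrite powRB ?(gt_eqF z0) ?implybT// powRr1// ltW.
by rewrite !H// ge0_ler_powR ?nnegrE ?subr_ge0 ?(ltW x0) ?(ltW y0).
Qed.

End Assembly.

Unset Implicit Arguments.

Theorem theorem3p2 (R : realType) (d : nat) (X : set 'rV[R]_d) (I : Type)
    (S : I -> X -> X) (HS : is_IIFS S) :
  [/\ (hausdorff_dim (limit_set S) <= h_exponent S)%E,
      (upper_box_dim (limit_set S) <=
         maxe (h_exponent S) (lim_hitting_dim S upper_box_dim))%E,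
      forall theta : R, 0 <= theta <= 1 ->
        (upper_theta_dim theta (limit_set S) <=
           maxe (h_exponent S) (lim_hitting_dim S (upper_theta_dim theta)))%E
    & forall (Delta : R) (Phi : R -> R), monotonically_admissible Delta Phi ->
        (upper_Phi_dim Delta Phi (limit_set S) <=
           maxe (h_exponent S) (lim_hitting_dim S (upper_Phi_dim Delta Phi)))%E].
Proof.
split.
- exact: hausdorff_dim_le_h.
- exact: upper_box_dim_limit_set.
- move=> theta /andP[theta0 theta1]; have [->|thetaN0] := eqVneq theta 0.
    by rewrite /upper_theta_dim eqxx le_max hausdorff_dim_le_h.
  have -> : upper_theta_dim theta = upper_Phi_dim 1 (fun x => x `^ theta^-1)
      :> (set 'rV[R]_d -> \bar R).
    by apply/funext => E; rewrite /upper_theta_dim (negbTE thetaN0).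
  have [|powP powmono] := @powR_inv_admissible R theta.
    by rewrite lt0r thetaN0 theta0.
  exact: upper_Phi_dim_limit_set.
- by move=> Delta Phi [? _ ? _ ?]; exact: upper_Phi_dim_limit_set.
Qed.
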